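(* Let $(G,\mu)$ be a multiplicative group, let $K \geq 1$, and let $A$ be a multiplicative set in $G$. Then the following three statements are equivalent, in the sense that if one of them holds for one choice of the implied absolute constants in the $O()$, $\lesssim$, $\sim$ notation, then the other statements hold for some (possibly different) choice of absolute constants: (i) $\mu(A^3) \lesssim K^{O(1)} \mu(A)$. (ii) For all $n \geq 1$ and all signs $\epsilon_1,\dots,\epsilon_n \in \{-1,+1\}$ we have $\mu(A^{\epsilon_1} \cdots A^{\epsilon_n}) \sim_n K^{O_n(1)} \mu(A)$. (iii) There exists an $O(K^{O(1)})$-approximate group $H$ with $\mu(H) \sim K^{O(1)} \mu(A)$ and $A \subseteq H$.
   Context: A multiplicative group is a topological group $G$ (multiplication and inversion continuous) equipped with a non-negative Radon measure $\mu$ invariant under left translation, right translation and inversion ($\mu(xA)=\mu(Ax)=\mu(A^{-1})=\mu(A)$ for measurable $A$ and $x\in G$), such that every non-empty open set has positive measure. A multiplicative set is a non-empty open precompact subset of $G$. For sets $A,B \subseteq G$, $A\cdot B=\{ab: a\in A, b\in B\}$, $A^{-1}=\{a^{-1}:a\in A\}$, $A^n$ is the $n$-fold product $A\cdots A$, and $A^{+1}=A$. A multiplicative set $H$ is a $K$-approximate group if $H^{-1}=H$ and there is a finite symmetric set $X\subseteq H\cdot H$ with $|X|\le K$ and $H\cdot H\subseteq X\cdot H$. Notation: $X \lesssim K^{O(1)} Y$ means $X \le C K^C Y$ for an absolute constant $C$ (independent of $G$, $A$, $K$); $X \gtrsim K^{O(1)}Y$ means $X \ge C^{-1}K^{-C}Y$;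 $X\sim K^{O(1)}Y$ means both; $O(K^{O(1)})$ denotes a quantity bounded by $CK^C$; a subscript $n$ means the constants may depend on $n$. *)

(* Defs.v *)
From HB Require Import structures.
From mathcomp Require Import all_boot all_order all_algebra.
From mathcomp Require Import finmap.
From mathcomp Require Import all_classical all_reals all_analysis.

Set Implicit Arguments.
Unset Strict Implicit.
Unset Printing Implicit Defensive.

Import Order.TTheory GRing.Theory Num.Theory.

Local Open Scope classical_set_scope.
Local Open Scope ring_scope.

HB.mixin Record isTopologicalGroup G & Group G & Topological G := {
  mulg_continuous : continuous (fun x : G * G => (x.1 * x.2)%g) ;
  invg_continuous : continuous (fun x : G => x^-1%g) ;
}.

(* [Pointed] only serves to build the measurable space of Borel sets; it is no
   restriction, a group being inhabited by 1. Neither separation nor local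
   compactness is assumed. *)
#[short(type="topologicalGroupType")]
HB.structure Definition TopologicalGroup :=
  {G of Group G & PointedTopological G & isTopologicalGroup G}.

Notation borelType G := (g_sigma_algebraType (@open G)).

Section Sets.
Context {G : topologicalGroupType}.
Implicit Types (A B : set G).

Definition mulSet A B : set G := [set (a * b)%g | a in A & b in B].

Definition invSet A : set G := [set a^-1%g | a in A].

Definition expSet n A : set G := iterop n mulSet A [set 1%g].

(* A sign is encoded as a boolean, as in [(-1) ^+ e]: [true] stands for -1. *)
Definition signSet (e : bool) A : set G := if e then invSet A else A.

Definition sign_prodSet n (eps : 'I_n -> bool) A : set G :=
  \big[mulSet/[set 1%g]]_(i < n) signSet (eps i) A.

Definition multiplicative_set A : Prop := [/\ A !=set0, open A & precompact A].

Definition approximate_group (R : realType) (K : R) (H : set G) : Prop :=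
  [/\ multiplicative_set H, invSet H = H &
    exists X : {fset G},
      [/\ invSet [set` X] = [set` X], [set` X] `<=` mulSet H H,
          #|` X|%:R <= K & mulSet H H `<=` mulSet [set` X] H]].

End Sets.

Section Measures.
Local Open Scope ereal_scope.
Context {R : realType} {G : topologicalGroupType}.
Variable mu : {measure set (borelType G) -> \bar R}.

(* The usual definition on locally compact spaces (outer regular on Borel sets,
   inner regular on open sets). Inner regularity uses closed compact sets so
   that they are Borel without a Hausdorff assumption; in a topological group
   the closure of a compact subset of an open U is a compact subset of U. *)
Record radon_measure : Prop := {
  radon_locally_finite : forall x : G, exists2 U : set G,
    open_nbhs x U & mu U < +oo ;
  radon_outer_regular : forall B : set (borelType G), measurable B ->
    mu B = ereal_inf [set mu U | U in [set U : set G | open U /\ B `<=` U]] ;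
  radon_inner_regular : forall U : set G, open U ->
    mu U = ereal_sup
      [set mu C | C in [set C : set G | [/\ compact C, closed C & C `<=` U]]] ;
}.

Record multiplicative_group : Prop := {
  mgroup_radon : radon_measure ;
  mgroup_mull : forall (x : G) (B : set (borelType G)), measurable B ->
    mu (mulSet [set x] B) = mu B ;
  mgroup_mulr : forall (x : G) (B : set (borelType G)), measurable B ->
    mu (mulSet B [set x]) = mu B ;
  mgroup_inv : forall B : set (borelType G), measurable B ->
    mu (invSet B) = mu B ;
  mgroup_open_gt0 : forall U : set G, open U -> U !=set0 -> 0 < mu U ;
}.

(* [x <~ K^O(1) y], [x >~ K^O(1) y] and [x ~ K^O(1) y], with explicit implied
   constant [C]. *)
Definition lesssim (C K : R) (x y : \bar R) : Prop :=
  x <= (C * K `^ C)%:E * y.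

Definition gtrsim (C K : R) (x y : \bar R) : Prop :=
  (C^-1 * K `^ (- C))%:E * y <= x.

Definition polysim (C K : R) (x y : \bar R) : Prop :=
  lesssim C K x y /\ gtrsim C K x y.

Definition small_tripling (C K : R) (A : set G) : Prop :=
  lesssim C K (mu (expSet 3 A)) (mu A).

(* The implied constants may depend on the number [n] of factors. *)
Definition small_sign_products (c : nat -> R) (K : R) (A : set G) : Prop :=
  forall n (eps : 'I_n -> bool), (1 <= n)%N ->
    polysim (c n) K (mu (sign_prodSet eps A)) (mu A).

Definition in_approximate_group (C K : R) (A : set G) : Prop :=
  exists H : set G,
    [/\ approximate_group (C * K `^ C)%R H, polysim C K (mu H) (mu A) &
        A `<=` H].

End Measures.

(* Main.v *)
Require Import Defs.
From mathcomp Require Import all_boot all_order all_algebra.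
From mathcomp Require Import finmap.
From mathcomp Require Import all_classical all_reals all_analysis.
From mathcomp Require Import measurable_realfun ring lra.

(* The engine is Ruzsa's triangle inequality
   [mu (A D) mu (B) <= mu (A B^-1) mu (B D)].  From [mu (A^3) <= L mu (A)] it
   bounds every product of three factors [A] or [A^-1] by [L^3 mu (A)], so the
   symmetric set [T = A u A^-1] has tripling at most [M = 8 L^3], and then
   [mu (T^(n+1)) <= M^n mu (T)]; this is (ii).  For (iii) take [H = T u T^2]: if
   [X] is a maximal subset of [H^2] whose translates [x T] are disjoint, then
   [X] is small by volume and [H^2] lies in [X T T^-1], hence in [X H].
   Conversely [A^3] lies in [H^3], hence in [X X H]. *)

Set Implicit Arguments.
Unset Strict Implicit.
Unset Printing Implicit Defensive.

Import Order.TTheory GRing.Theory Num.Theory.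

Local Open Scope classical_set_scope.
Local Open Scope ring_scope.

Local Notation "A ** B" := (mulSet A B) (at level 40, left associativity).

(** * Algebra of product sets, inverses and powers *)

Section SetAlgebra.
Context {G : topologicalGroupType}.
Implicit Types (A B C D U : set G) (x y : G).

Lemma mulSetA A B C : A ** (B ** C) = A ** B ** C.
Proof.
apply/seteqP; split=> [_ [a Aa [_ [b Bb [c Cc <-]] <-]]|].
  by exists (a * b)%g; [exists a => //; exists b | exists c => //; rewrite mulgA].
move=> _ [_ [a Aa [b Bb <-]] [c Cc <-]].
  by exists a => //; exists (b * c)%g; [exists b => //; exists c | rewrite mulgA].
Qed.

Lemma mulSetS A A' B B' : A `<=` A' -> B `<=` B' -> A ** B `<=` A' ** B'.
Proof.
by move=> sA sB _ [a /sA A'a [b /sB B'b <-]]; exists a => //; exists b.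
Qed.

Lemma mulSet1r A : A ** [set 1%g] = A.
Proof.
apply/seteqP; split=> [_ [a Aa [_ -> <-]]|a Aa]; first by rewrite mulg1.
by exists a => //; exists 1%g => //; rewrite mulg1.
Qed.

Lemma mulSetUl A B C : (A `|` B) ** C = (A ** C) `|` (B ** C).
Proof.
apply/seteqP; split=> [_ [a [Aa|Ba] [c Cc <-]]|_ [] [a Aa [c Cc <-]]].
- by left; exists a => //; exists c.
- by right; exists a => //; exists c.
- by exists a; [left | exists c].
- by exists a; [right | exists c].
Qed.

Lemma mulSetUr A B C : A ** (B `|` C) = (A ** B) `|` (A ** C).
Proof.
apply/seteqP; split=> [_ [a Aa [c [Bc|Cc] <-]]|_ [] [a Aa [c Cc <-]]].
- by left; exists a => //; exists c.
- by right; exists a => //; exists c.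
- by exists a => //; exists c => //; left.
- by exists a => //; exists c => //; right.
Qed.

(** Reduces the openness and the measure of a product to those of left translates. *)
Lemma mulSet_bigcupl A B : A ** B = \bigcup_(a in A) ([set a] ** B).
Proof.
apply/seteqP; split=> [_ [a Aa [b Bb <-]]|_ [a Aa [_ -> [b Bb <-]]]].
- by exists a => //; exists a => //; exists b.
- by exists a => //; exists b.
Qed.

(** As a preimage under a continuous map, the inverse set inherits openness and closedness;
    [mul_set1E] does the same for translates. *)
Lemma invSetE A : invSet A = (fun x => x^-1%g) @^-1` A.
Proof.
apply/seteqP; split=> [_ [a Aa <-]|x Ax] /=; first by rewrite invgK.
by exists (x^-1)%g => //; rewrite invgK.
Qed.

Lemma invSetK A : invSet (invSet A) = A.
Proof.
by apply/seteqP; split=> x; rewrite !invSetE /= invgK.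
Qed.

Lemma invSetM A B : invSet (A ** B) = invSet B ** invSet A.
Proof.
apply/seteqP; split=> [_ [_ [a Aa [b Bb <-]] <-]|].
- by exists (b^-1)%g; [exists b | exists (a^-1)%g; [exists a|rewrite invgM]].
- move=> _ [_ [b Bb <-] [_ [a Aa <-] <-]].
  by exists (a * b)%g; [exists a => //; exists b | rewrite invgM].
Qed.

Lemma invSetU A B : invSet (A `|` B) = invSet A `|` invSet B.
Proof. by rewrite !invSetE preimage_setU. Qed.

Lemma mul_set1E x A : [set x] ** A = (fun y => x^-1 * y)%g @^-1` A.
Proof.
apply/seteqP; split=> [_ [_ -> [a Aa <-]]|y Ay] /=; first by rewrite mulKg.
by exists x => //; exists (x^-1 * y)%g => //; rewrite mulVKg.
Qed.

Lemma expSetS n A : expSet n.+1 A = A ** expSet n A.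
Proof. by case: n => [|n] //=; rewrite mulSet1r. Qed.

Lemma expSet3 A : expSet 3 A = A ** A ** A.
Proof. by rewrite -mulSetA. Qed.

Lemma expSetD n p A : (0 < n)%N -> (0 < p)%N ->
  expSet (n + p) A = expSet n A ** expSet p A.
Proof.
case: p => // p; elim: n => // -[|n] IH _ _; first by rewrite add1n expSetS.
by rewrite addSn expSetS IH // mulSetA -expSetS.
Qed.

Lemma invSet_exp n A : invSet A = A -> invSet (expSet n A) = expSet n A.
Proof.
move=> sA; elim: n => [|n IH].
  rewrite /expSet /= invSetE; apply/seteqP; split=> x /= /eqP.
    by rewrite invg_eq1 => /eqP.
  by rewrite -invg_eq1 => /eqP.
case: n IH => [//|n] IH.
(* Inversion moves the first factor to the end, so [expSetD] is needed to bring it back to the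
   front. *)
by rewrite expSetS invSetM IH sA -[X in _ ** X]/(expSet 1 A) -expSetD // addn1 -expSetS.
Qed.

Lemma sign_prodSet_sub n (eps : 'I_n -> bool) A T :
  A `<=` T -> invSet A `<=` T -> sign_prodSet eps A `<=` expSet n T.
Proof.
rewrite /sign_prodSet => AT VT; elim: n eps => [|n IH] eps.
  by rewrite big_ord0.
rewrite big_ord_recl expSetS; apply: mulSetS; last exact: IH.
by rewrite /signSet; case: (eps _).
Qed.

End SetAlgebra.

(** * Open, closed and compact sets under the group operations *)

Section Topology.
Context {G : topologicalGroupType}.
Implicit Types (A B C D U : set G) (x y : G).

Lemma mulg_continuousl x : continuous (fun y : G => x * y)%g.
Proof.
move=> y U /(@mulg_continuous G (x, y)) [[P Q] [/= nP nQ] PQ].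
rewrite /nbhs /=; apply: filterS nQ => z Qz.
by apply: (PQ (x, z)); split=> //=; exact: nbhs_singleton.
Qed.

Lemma mulg_continuousr x : continuous (fun y : G => y * x)%g.
Proof.
move=> y U /(@mulg_continuous G (y, x)) [[P Q] [/= nP nQ] PQ].
rewrite /nbhs /=; apply: filterS nP => z Pz.
by apply: (PQ (z, x)); split=> //=; exact: nbhs_singleton.
Qed.

Lemma open_mul1 x A : open A -> open ([set x] ** A).
Proof.
by move=> oA; rewrite mul_set1E; apply: open_comp => // y _; exact: mulg_continuousl.
Qed.

Lemma closed_mul1 x A : closed A -> closed ([set x] ** A).
Proof.
move=> cA; rewrite mul_set1E; apply: preimage_closed => // y _.
exact: mulg_continuousl.
Qed.

Lemma open_inv A : open A -> open (invSet A).
Proof.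
by move=> oA; rewrite invSetE; apply: open_comp => // y _; exact: invg_continuous.
Qed.

Lemma closed_inv A : closed A -> closed (invSet A).
Proof.
by move=> cA; rewrite invSetE; apply: preimage_closed => // y _; exact: invg_continuous.
Qed.

Lemma open_mulr A B : open B -> open (A ** B).
Proof.
move=> oB; rewrite mulSet_bigcupl; apply: bigcup_open => a _.
exact: open_mul1.
Qed.

Lemma compact_inv A : compact A -> compact (invSet A).
Proof.
apply: continuous_compact; apply: continuous_subspaceT.
exact: invg_continuous.
Qed.

Lemma compact_mul A B : compact A -> compact B -> compact (A ** B).
Proof.
move=> cA cB.
have -> : A ** B = (fun p : G * G => p.1 * p.2)%g @` (A `*` B).
  apply/seteqP; split=> [_ [a Aa [b Bb <-]]|_ [[a b] [/= Aa Bb] <-]].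
  - by exists (a, b).
  - by exists a => //; exists b.
apply: continuous_compact; last exact: compact_setX.
by apply: continuous_subspaceT; exact: mulg_continuous.
Qed.

(** A tube lemma: continuity of the product at [(1, x)] gives a neighbourhood of 1 for each [x] in
    [C], and compactness, as a near-covering property, makes it uniform in [x]. *)
Lemma compact_thicken C U : compact C -> open U -> C `<=` U ->
  exists W, open_nbhs (1%g : G) W /\ W ** C `<=` U.
Proof.
move=> cC oU CU.
have := (compact_near_coveringP C).1 cC G (nbhs (1%g : G))
   (fun w x => U (w * x)%g) _.
have H x : C x -> \forall x' \near x & w \near (1%g : G), U (w * x')%g.
  move=> /CU Ux.
  have : nbhs (1 * x)%g U by rewrite mul1g; apply: open_nbhs_nbhs.
  move=> /(@mulg_continuous G (1%g, x)) [[P Q] [/= nP nQ]] PQ.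
  by exists (Q, P) => // -[a b] [/= Qa Pb]; exact: (PQ (b, a)).
move=> /(_ _ H); rewrite nbhsE => -[W [oW W1] WC].
exists W; split; first by split.
by move=> _ [w Ww [c Cc <-]]; exact: WC.
Qed.

(** If [x] is not in [A B], the compact [A] lies in the open complement of [x B^-1], and so does
    [W A] for some neighbourhood [W] of 1. Then [W^-1 x] misses [A B]: if [y = a b] with [x y^-1] in
    [W], then [x y^-1 a = x b^-1] would lie in both [W A] and [x B^-1]. *)
Lemma closed_mul_compact A B : compact A -> closed B -> closed (A ** B).
Proof.
move=> cA cB; rewrite -[A ** B]setCK; apply: open_closedC.
rewrite openE => x xAB; rewrite /interior.
have oU : open (~` ([set x] ** invSet B)).
  by apply: closed_openC; apply: closed_mul1; exact: closed_inv.
have AU : A `<=` ~` ([set x] ** invSet B).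
  move=> a Aa [_ -> [_ [b Bb <-] e]]; apply: xAB.
  by exists a => //; exists b => //; rewrite -e mulgVK.
have [W [[oW W1] WU]] := compact_thicken cA oU AU.
have : nbhs (x * x^-1)%g (invSet W).
  rewrite mulgV; apply: open_nbhs_nbhs; split; first exact: open_inv.
  by rewrite invSetE /= invg1.
move=> /(@mulg_continuousr (x^-1)%g x); rewrite /nbhs /=; apply: filterS.
move=> y /=; rewrite invSetE /= invgM invgK => Wxy [a Aa [b Bb e]].
apply: (WU (x * y^-1 * a)%g); first by exists (x * y^-1)%g => //; exists a.
exists x => //; exists (b^-1)%g; first by exists b.
by rewrite -e invgM -!mulgA mulVg mulg1.
Qed.

Lemma multiplicative_mul A B :
  multiplicative_set A -> multiplicative_set B -> multiplicative_set (A ** B).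
Proof.
move=> [[a Aa] oA [A' AA' [cA' clA']]] [[b Bb] oB [B' BB' [cB' clB']]]; split.
- by exists (a * b)%g; exists a => //; exists b.
- exact: open_mulr.
- exists (A' ** B'); last by split; [exact: compact_mul|exact: closed_mul_compact].
  exact: mulSetS.
Qed.

Lemma multiplicative_mul3 A B C : multiplicative_set A ->
  multiplicative_set B -> multiplicative_set C -> multiplicative_set (A ** B ** C).
Proof. by move=> mA mB mC; do 2![apply: multiplicative_mul => //]. Qed.

Lemma multiplicative_inv A :
  multiplicative_set A -> multiplicative_set (invSet A).
Proof.
move=> [[a Aa] oA [A' AA' [cA' clA']]]; split.
- by exists (a^-1)%g; exists a.
- exact: open_inv.
- exists (invSet A'); last by split; [exact: compact_inv|exact: closed_inv].
  by move=> _ [x Ax <-]; exists x => //; exact: AA'.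
Qed.

Lemma multiplicative_setU A B :
  multiplicative_set A -> multiplicative_set B -> multiplicative_set (A `|` B).
Proof.
move=> [[a Aa] oA [A' AA' [cA' clA']]] [_ oB [B' BB' [cB' clB']]]; split.
- by exists a; left.
- exact: openU.
- exists (A' `|` B'); last by split; [exact: compactU|exact: closedU].
  exact: setUSS.
Qed.

Lemma multiplicative_exp n A : (0 < n)%N ->
  multiplicative_set A -> multiplicative_set (expSet n A).
Proof.
move=> + mA; elim: n => // -[|n] IH _ //.
by rewrite expSetS; apply: multiplicative_mul => //; exact: IH.
Qed.

Lemma multiplicative_sign_prod n (eps : 'I_n -> bool) A : (0 < n)%N ->
  multiplicative_set A -> multiplicative_set (sign_prodSet eps A).
Proof.
rewrite /sign_prodSet => + mA.
have mS e : multiplicative_set (signSet e A).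
  by case: e => //; exact: multiplicative_inv.
elim: n eps => // -[|n] IH eps _; rewrite big_ord_recl.
  by rewrite big_ord0 mulSet1r.
by apply: multiplicative_mul => //; exact: IH.
Qed.

(** The centres form a sequence, so that the cover can later be made disjoint by [seqDU]; beyond the
    finite list they take the default value 1. *)
Lemma precompact_subcover A (f : G -> set G) :
  precompact A -> (forall x, open_nbhs x (f x)) ->
  exists n (y : nat -> G), A `<=` \big[setU/set0]_(i < n) f (y i).
Proof.
move=> [C AC [cC _]] fx.
move: cC; rewrite compact_cover => /(_ G C f) [].
- by move=> y _; case: (fx y).
- by move=> x Cx; exists x => //; case: (fx x).
- move=> D _ CD; exists (size (enum_fset D)), (nth 1%g (enum_fset D)) => x.
  move=> /AC /CD [y Dy xy].
  rewrite -(bigcup_mkord _ (fun i => f (nth 1%g (enum_fset D) i))).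
  exists (index y (enum_fset D)); last by rewrite nth_index.
  by rewrite /= index_mem.
Qed.

End Topology.

(** * Finite covers and the triangle inequality for compact sets *)

Section Measure.
Local Open Scope ereal_scope.
Context {R : realType} {G : topologicalGroupType}.
Context (mu : {measure set (borelType G) -> \bar R}).
Implicit Types (A B C D U : set G) (x y : G).

Local Notation bmeasurable U := (measurable (U : set (borelType G))).

Lemma open_bmeasurable U : open U -> bmeasurable U.
Proof. by move=> oU; exact: sub_sigma_algebra. Qed.

Lemma closed_bmeasurable C : closed C -> bmeasurable C.
Proof.
move=> cC; rewrite -[C]setCK; apply: measurableC; apply: open_bmeasurable.
exact: closed_openC.
Qed.

(** Integrate the pointwise bound over [S]: the [i]-th term contributes [w i] times the measure of
    the part of [F i] inside [S]. *)
Lemma weighted_cover_le n (w : 'I_n -> \bar R) (F : 'I_n -> set G) S (c : \bar R) :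
  (forall i, 0 <= w i) -> (forall i, bmeasurable (F i)) -> bmeasurable S ->
  0 <= c -> (forall x, S x -> c <= \sum_(i < n) w i * (\1_(F i) x)%:E) ->
  c * mu S <= \sum_(i < n) w i * mu (F i).
Proof.
move=> w0 mF mS c0 cw.
rewrite -(@integral_cst _ (borelType G) R mu S mS c).
pose f i : borelType G -> \bar R := fun x => w i * (\1_(F i) x)%:E.
have mf i : measurable_fun (S : set (borelType G)) (f i).
  apply: measurable_funeM; apply/measurable_EFinP; exact: measurable_indic.
have f0 i (x : borelType G) : S x -> 0 <= f i x.
  by move=> _; apply: mule_ge0 => //; rewrite lee_fin.
apply: (@le_trans _ _ (\int[mu]_(x in (S : set (borelType G)))
   (\sum_(i < n) f i x))).
  by apply: ge0_le_integral => //; exact: emeasurable_sum.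
rewrite ge0_integral_sum //.
apply: lee_sum => i _; rewrite ge0_integralZl //.
- apply: lee_wpmul2l => //; rewrite integral_indic //.
  by apply: le_measure; rewrite ?inE //; exact: measurableI.
- by apply/measurable_EFinP; exact: measurable_indic.
Qed.

(** Removing from each [F i] the earlier sets makes the cover disjoint, and the measure of [S] then
    adds up exactly. *)
Lemma measure_disjointify (F : nat -> set G) n S :
  (forall i, bmeasurable (F i)) -> bmeasurable S ->
  S `<=` \big[setU/set0]_(i < n) F i ->
  mu S = \sum_(i < n) mu (S `&` seqDU F i).
Proof.
move=> mF mS SF.
have mD i : bmeasurable (seqDU F i) by exact: (@seqDU_measurable _ (borelType G)).
rewrite -(@measure_semi_additive_ord _ _ _ mu n (fun i => S `&` seqDU F i)).
- by rewrite -big_distrr /= -bigsetU_seqDU (setIidl SF).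
- by move=> i; exact: measurableI.
- apply: trivIset_setIl; move=> i j _ _ h; apply: val_inj.
  exact: (@trivIset_seqDU _ F).
- by apply: bigsetU_measurable => i _; exact: measurableI.
Qed.



Context (hmu : multiplicative_group mu).

(** Finitely many open sets of finite measure cover [S], by local finiteness. *)
Lemma measure_finite S : precompact S -> open S -> mu S < +oo.
Proof.
move=> pS oS.
have /choice[U hU] : forall x, exists U : set G, open_nbhs x U /\ mu U < +oo.
  by move=> x; have [U oU U1] := radon_locally_finite (mgroup_radon hmu) x; exists U.
have [n [y SU]] := precompact_subcover pS (fun x => (hU x).1).
apply: (@le_lt_trans _ _ (\sum_(i < n) mu (U (y i)))).
  apply: (@content_subadditive _ _ _ mu _ (fun i => U (y i))) => //.
    by move=> k _; apply: open_bmeasurable; case: (hU (y k)) => -[].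
  exact: open_bmeasurable.
by apply: lte_sum_pinfty => i _; case: (hU (y i)).
Qed.

(* The classical proof bounds the convolution of the indicators of [A B^-1] and
   [B D] from below by [mu B] on [A D], and then uses Fubini.  Here [A B^-1] is
   cut into finitely many pieces, each in a translate of a neighbourhood [W] of
   1 such that [W C] is in [B]; the convolution becomes a finite sum. *)
Lemma Ruzsa_triangle_compact A B D C :
  open A -> open B -> open D -> precompact (A ** invSet B) ->
  compact C -> closed C -> C `<=` B ->
  mu C * mu (A ** D) <= mu (A ** invSet B) * mu (B ** D).
Proof.
move=> oA oB oD pP cC clC CB; set P := A ** invSet B.
have [W [[oW W1] WCB]] := compact_thicken cC oB CB.
have nW x : open_nbhs x ([set x] ** W).
  by split; [exact: open_mul1 | exists x => //; exists 1%g => //; rewrite mulg1].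
have [n [y Py]] := precompact_subcover pP nW.
pose F i := [set y i] ** W.
have mF i : bmeasurable (F i) by apply: open_bmeasurable; exact: open_mul1.
have mP : bmeasurable P.
  by apply: open_bmeasurable; apply: open_mulr; exact: open_inv.
have mBD : bmeasurable (B ** D) by apply: open_bmeasurable; exact: open_mulr.
have mDU i : bmeasurable (seqDU F i) by exact: (@seqDU_measurable _ (borelType G)).
have muP : mu P = \sum_(i < n) mu (P `&` seqDU F i).
  exact: measure_disjointify.
(* By left invariance the right side becomes a weighted sum of the measures of [y_i B D]. It remains
   to see that, at each point of [A D], the weights of the sets [y_i B D] containing it add up to at
   least [mu C]. *)
have -> : mu P * mu (B ** D) =
    \sum_(i < n) mu (P `&` seqDU F i) * mu ([set y i] ** (B ** D)).
  rewrite muP ge0_sume_distrl; last by move=> i _; exact: measure_ge0.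
  by apply: eq_bigr => i _; rewrite (mgroup_mull hmu).
apply: weighted_cover_le => //.
- by move=> i; apply: open_bmeasurable; apply: open_mul1; exact: open_mulr.
- by apply: open_bmeasurable; exact: open_mulr.
- move=> _ [a Aa [d Dd <-]].
  (* At the point [a d], the test set [a C^-1] lies in [P] and has measure [mu C]; only pieces with
     [a d] in [y_i B D] can meet it. *)
  pose S := [set a] ** invSet C.
  have SP : S `<=` P.
    by apply: mulSetS => [_ ->//|_ [c Cc <-]]; exists c => //; exact: CB.
  have mC : bmeasurable (invSet C).
    by apply: closed_bmeasurable; exact: closed_inv.
  have mS : bmeasurable S.
    by apply: closed_bmeasurable; apply: closed_mul1; exact: closed_inv.
  have -> : mu C = mu S.
    by rewrite (mgroup_mull hmu) // (mgroup_inv hmu) //; exact: closed_bmeasurable.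
  rewrite (measure_disjointify mF mS (subset_trans SP Py)).
  apply: lee_sum => i _; rewrite indicE.
  case: (boolP (_ \in _)) => [_|]; rewrite /= ?mule1 ?mule0.
    by apply: le_measure; rewrite ?inE;
      [exact: measurableI | exact: measurableI | exact: setSI].
  (* A common point [a c^-1 = y_i v] with [v] in [W] would give [a d = y_i (v c) d], where [v c]
     lies in [W C], hence in [B]. *)
  move=> /negP nx; rewrite (_ : S `&` _ = set0) ?measure0 //.
  rewrite -subset0 => _ [[_ -> [_ [c Cc <-] <-]]] /= [[_ -> [v Wv e]] _].
  apply: nx; rewrite inE; exists (y i) => //; exists (v * c * d)%g.
    by exists (v * c)%g; [apply: WCB; exists v => //; exists c | exists d].
  by rewrite !mulgA e mulgVK.
Qed.

End Measure.

(** * Real-valued volumes of multiplicative sets *)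

Section Volume.
Context {R : realType} {G : topologicalGroupType}.
Context (mu : {measure set (borelType G) -> \bar R}).
Context (hmu : multiplicative_group mu).
Implicit Types (A B C D U S T : set G) (x y : G).

Local Notation vol S := (fine (mu S)).

Lemma multiplicative_measure S : multiplicative_set S -> mu S = (vol S)%:E.
Proof.
move=> [_ oS pS]; rewrite fineK // ge0_fin_numE ?measure_ge0 //.
exact: measure_finite.
Qed.

Lemma vol_gt0 S : multiplicative_set S -> 0 < vol S.
Proof.
move=> mS; rewrite -lte_fin -multiplicative_measure //.
by case: mS => S0 oS _; exact: (mgroup_open_gt0 hmu).
Qed.

Lemma vol_le S T : multiplicative_set S -> multiplicative_set T ->
  S `<=` T -> vol S <= vol T.
Proof.
move=> mS mT ST; rewrite -lee_fin -!multiplicative_measure //.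
by apply: le_measure; rewrite ?inE //; apply: open_bmeasurable;
  [case: mS|case: mT].
Qed.

Lemma vol_inv S : multiplicative_set S -> vol (invSet S) = vol S.
Proof.
by move=> [_ oS _]; rewrite (mgroup_inv hmu) //; exact: open_bmeasurable.
Qed.

Lemma vol_mul1 x S : multiplicative_set S -> vol ([set x] ** S) = vol S.
Proof.
by move=> [_ oS _]; rewrite (mgroup_mull hmu) //; exact: open_bmeasurable.
Qed.

Lemma vol_setU S T : multiplicative_set S -> multiplicative_set T ->
  vol (S `|` T) <= vol S + vol T.
Proof.
move=> mS mT; have mST := multiplicative_setU mS mT.
rewrite -lee_fin EFinD -!multiplicative_measure //.
by apply: measureU2; apply: open_bmeasurable; [case: mS|case: mT].
Qed.

(** After division by [vol (A D)], the compact case bounds [mu C] for every closed compact [C]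
    inside [B]; inner regularity takes the supremum. *)
Lemma Ruzsa_triangle A B D :
  multiplicative_set A -> multiplicative_set B -> multiplicative_set D ->
  vol (A ** D) * vol B <= vol (A ** invSet B) * vol (B ** D).
Proof.
move=> mA mB mD.
have mAD := multiplicative_mul mA mD.
have mBD := multiplicative_mul mB mD.
have mAB := multiplicative_mul mA (multiplicative_inv mB).
rewrite mulrC -ler_pdivlMr ?vol_gt0 // -lee_fin -multiplicative_measure //.
case: (mA) (mB) (mD) (mAB) => [_ oA _] [_ oB _] [_ oD _] [_ _ pAB].
rewrite (radon_inner_regular (mgroup_radon hmu) oB).
apply: ge_ereal_sup => _ [C [cC clC CB] <-].
have := Ruzsa_triangle_compact hmu oA oB oD pAB cC clC CB.
rewrite (multiplicative_measure mAD) (multiplicative_measure mAB).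
rewrite (multiplicative_measure mBD) -EFinM => h.
by rewrite EFinM lee_pdivlMr ?vol_gt0.
Qed.

End Volume.

(** * Covering, product growth and approximate groups *)

Section Growth.
Context {R : realType} {G : topologicalGroupType}.
Context (mu : {measure set (borelType G) -> \bar R}).
Context (hmu : multiplicative_group mu).
Implicit Types (A B C D U S T H : set G) (x y : G) (X : {fset G}).

Local Notation vol S := (fine (mu S)).

Lemma sum_measure_translates X S : open S ->
  (\sum_(x \in [set` X]) mu ([set x] ** S) = (#|` X|%:R)%:E * mu S)%E.
Proof.
move=> oS; rewrite -fsbig_seq ?fset_uniq // (eq_bigr (fun=> mu S)); last first.
  by move=> x _; rewrite (mgroup_mull hmu) //; exact: open_bmeasurable.
by rewrite big_const_seq count_predT iter_addr_0 mule_natl.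
Qed.

Lemma measure_fset_mul X S : open S ->
  (mu ([set` X] ** S) <= (#|` X|%:R)%:E * mu S)%E.
Proof.
move=> oS; rewrite -sum_measure_translates //.
apply: content_sub_fsum => //.
- by move=> x _; apply: open_bmeasurable; exact: open_mul1.
- by apply: open_bmeasurable; exact: open_mulr.
- by rewrite [X in X `<=` _]mulSet_bigcupl.
Qed.

(** Among the finite subsets of [S] with pairwise disjoint translates of [T], take one of maximal
    size. A further [s] in [S] has [s t = x u] for some [x] in it and [t], [u] in [T], so
    [s = x u t^-1]. *)
Lemma Ruzsa_covering S T : multiplicative_set S -> multiplicative_set T ->
  exists X, [/\ [set` X] `<=` S, #|` X|%:R * vol T <= vol (S ** T) &
    S `<=` [set` X] ** (T ** invSet T)].
Proof.
move=> mS mT.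
have mST := multiplicative_mul mS mT.
have oT : open T by case: mT.
pose separated X := [set` X] `<=` S /\ forall x y t u, x \in X -> y \in X ->
  T t -> T u -> (x * t = y * u)%g -> x = y.
have bound X : separated X -> #|` X|%:R * vol T <= vol (S ** T).
  move=> [XS sX]; rewrite -lee_fin EFinM -!multiplicative_measure //.
  have <- : mu ([set` X] ** T) = ((#|` X|%:R)%:E * mu T)%E.
    rewrite -sum_measure_translates // mulSet_bigcupl measure_fin_bigcup //.
      move=> x y Xx Xy [_ [[_ -> [t Tt <-]] [_ -> [u Tu e]]]].
      by apply: (sX x y t u).
    by move=> x _; apply: open_bmeasurable; exact: open_mul1.
  apply: le_measure; rewrite ?inE; last exact: mulSetS.
  - by apply: open_bmeasurable; exact: open_mulr.
  - by apply: open_bmeasurable; exact: open_mulr.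
pose P k := `[< exists2 X, separated X & #|` X| = k >].
have exP : exists k, P k.
  exists 0%N; apply/asboolP; exists fset0; last exact: cardfs0.
  by split=> // x.
(* The volume bound caps the size of separated sets, so a maximal size exists. *)
have maxP k : P k -> (k <= Num.bound (vol (S ** T) / vol T))%N.
  move=> /asboolP[X /bound + <-]; rewrite -ler_pdivlMr ?vol_gt0 // => le.
  rewrite ltnW // -(ltr_nat R); apply: le_lt_trans le _.
  by apply: archi_boundP; apply: divr_ge0; apply: ltW; exact: vol_gt0.
case: (ex_maxnP exP maxP) => k /asboolP[X sX Xk] kmax.
exists X; split; [by case: sX|exact: bound|move=> s Ss].
apply: contrapT => sXTT.
have sNX : s \notin X.
  apply/negP => sX'; apply: sXTT; case: mT => -[t Tt] _ _.
  exists s => //; exists 1%g; last by rewrite mulg1.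
  by exists t => //; exists (t^-1)%g; [exists t | rewrite mulgV].
have sep x t u : x \in X -> T t -> T u -> (s * t)%g <> (x * u)%g.
  move=> Xx Tt Tu e; apply: sXTT; exists x => //; exists (u * t^-1)%g.
    by exists u => //; exists (t^-1)%g => //; exists t.
  by rewrite mulgA -e mulgK.
(* If [s] is not covered, adding it keeps the set separated, against maximality. *)
have : P k.+1.
  apply/asboolP; exists (s |` X)%fset; last by rewrite cardfsU1 sNX Xk.
  case: sX => XS sX; split.
    by move=> x /=; rewrite !inE => /orP[/eqP ->//|]; exact: XS.
  move=> x y t u; rewrite !inE => /orP[/eqP ->|Xx] /orP[/eqP ->|Xy] Tt Tu e //.
  - by case: (sep y t u).
  - by case: (sep x u t).
  - exact: (sX x y t u).
by move/kmax; rewrite ltnn.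
Qed.

(** The product contains a left translate of [T]. *)
Lemma vol_le_mull S T : multiplicative_set S -> multiplicative_set T ->
  vol T <= vol (S ** T).
Proof.
move=> mS mT; have [[s Ss] _ _] := mS.
rewrite -(vol_mul1 hmu s mT).
apply: vol_le => //; last by apply: mulSetS => // _ ->.
  have [[t Tt] oT pT] := mT; split; [|exact: open_mul1|].
    by exists (s * t)%g; exists s => //; exists t.
  have [_ _ ] := multiplicative_mul mS mT.
  by apply: precompact_subset; apply: mulSetS => // _ ->.
exact: multiplicative_mul.
Qed.

Lemma Ruzsa_bound A B D b c :
  multiplicative_set A -> multiplicative_set B -> multiplicative_set D ->
  vol (A ** invSet B) <= b * vol B -> vol (B ** D) <= c * vol B ->
  vol (A ** D) <= b * c * vol B.
Proof.
move=> mA mB mD hb hc.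
have B0 := vol_gt0 hmu mB.
have b0 : 0 < vol (A ** invSet B).
  by apply: vol_gt0 => //; apply: multiplicative_mul => //; exact: multiplicative_inv.
have c0 : 0 < vol (B ** D) by apply: vol_gt0 => //; exact: multiplicative_mul.
rewrite -(ler_pM2r B0); apply: le_trans (Ruzsa_triangle hmu mA mB mD) _.
rewrite (_ : b * c * _ * _ = (b * vol B) * (c * vol B)); last by ring.
by apply: ler_pM => //; exact: ltW.
Qed.

(** With [V = A^-1], the cube of the union expands into eight triple products. Four are bounded by
    the triangle inequality or by hypothesis, and the other four are their inverses; [L >= 1] lets
    [L^3] bound them all. *)
Lemma sym_hull_tripling A L : multiplicative_set A -> 1 <= L ->
  vol (A ** A ** A) <= L * vol A ->
  vol (expSet 3 (A `|` invSet A)) <= 8 * L ^+ 3 * vol A.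
Proof.
move=> mA L1 hA; set V := invSet A; set m := vol A.
have mV : multiplicative_set V by exact: multiplicative_inv.
have VK : invSet V = A by rewrite /V invSetK.
have vV : vol V = m by exact: vol_inv.
have M S T := @multiplicative_mul G S T.
have AA : vol (A ** A) <= L * m.
  by apply: le_trans hA; rewrite -mulSetA; apply: vol_le_mull => //; exact: M.
have VV : vol (V ** V) <= L * m by rewrite -invSetM vol_inv //; exact: M.
(* The middle set is [V]: the two sides are [A A A] and [V V]. *)
have AAV : vol (A ** A ** V) <= L * L * m.
  by rewrite -vV; apply: Ruzsa_bound; rewrite ?VK ?vV //; exact: M.
have VAA : vol (V ** (A ** A)) <= L * L * m.
  by apply: Ruzsa_bound => //; rewrite ?mulSetA //; exact: M.
have AVV : vol (A ** V ** V) <= L * L * m.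
  have -> : A ** V ** V = invSet (A ** A ** V) by rewrite !invSetM VK mulSetA.
  by rewrite vol_inv //; exact: multiplicative_mul3.
(* The middle set is [A]: the sides [A V V] and [A A] cost [L^2] and [L], which is where the cube of
   [L] comes from. *)
have AVA : vol (A ** V ** A) <= L * L * L * m.
  by apply: Ruzsa_bound => //; exact: M.
have L2 : L * L * m <= L ^+ 3 * m.
  by rewrite ler_pM2r ?vol_gt0 // -expr2; exact: ler_weXn2l.
have LL : L * m <= L ^+ 3 * m.
  by rewrite ler_pM2r ?vol_gt0 // -[X in X <= _]expr1; exact: ler_weXn2l.
have L3 : L * L * L * m <= L ^+ 3 * m by rewrite (_ : L * L * L = L ^+ 3) //; ring.
pose bounded S c := multiplicative_set S /\ vol S <= c.
have bU S T c d : bounded S c -> bounded T d -> bounded (S `|` T) (c + d).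
  move=> [mS hS] [mT hT]; split; first exact: multiplicative_setU.
  by apply: le_trans (vol_setU hmu mS mT) _; exact: lerD.
have bI S T U c : bounded (S ** T ** U) c -> multiplicative_set S ->
    multiplicative_set T -> multiplicative_set U ->
    bounded (invSet U ** invSet T ** invSet S) c.
  move=> [mSTU h] mS mT mU; rewrite -mulSetA -!invSetM; split.
    exact: multiplicative_inv.
  by rewrite vol_inv.
set c := L ^+ 3 * m.
have b1 : bounded (A ** A ** A) c.
  by split; [exact: multiplicative_mul3|exact: le_trans LL].
have b2 : bounded (A ** A ** V) c.
  by split; [exact: multiplicative_mul3|exact: le_trans L2].
have b3 : bounded (A ** V ** A) c.
  by split; [exact: multiplicative_mul3|exact: le_trans L3].
have b4 : bounded (V ** A ** A) c.
  by split; [exact: multiplicative_mul3|rewrite -mulSetA; exact: le_trans L2].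
have b5 : bounded (V ** V ** V) c by exact: bI b1 _ _ _.
have b6 : bounded (A ** V ** V) c by rewrite -[X in X ** _ ** _]VK; exact: bI b2 _ _ _.
have b7 : bounded (V ** A ** V) c by rewrite -[X in _ ** X ** _]VK; exact: bI b3 _ _ _.
have b8 : bounded (V ** V ** A) c by rewrite -[X in _ ** _ ** X]VK; exact: bI b4 _ _ _.
have [_] : bounded (expSet 3 (A `|` V)) ((c + c + (c + c)) + (c + c + (c + c))).
  rewrite expSet3 !mulSetUl !mulSetUr !mulSetUl.
  by do !apply/bU.
by rewrite /c; congr (_ <= _); ring.
Qed.

(** Induction by the triangle inequality with middle set [T]: [T^2 T^-1 = T^3] costs [M], and
    [T T^(n+1)] is the previous power. *)
Lemma vol_exp T M n : multiplicative_set T -> invSet T = T -> 1 <= M ->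
  vol (expSet 3 T) <= M * vol T -> vol (expSet n.+1 T) <= M ^+ n * vol T.
Proof.
move=> mT sT M1 hM; have T0 := vol_gt0 hmu mT.
have M0 : 0 < M by exact: lt_le_trans M1.
have mE k : multiplicative_set (expSet k.+1 T) by exact: multiplicative_exp.
elim: n => [|[|n] IH]; first by rewrite expr0 mul1r.
  rewrite expr1; apply: le_trans hM; rewrite [expSet 3 T]expSetS.
  by apply: vol_le_mull.
rewrite (@expSetD _ 2 n.+1) // exprS.
apply: (Ruzsa_bound (mE 1%N) mT (mE n)); last by rewrite -expSetS.
by rewrite sT -[X in _ ** X]/(expSet 1 T) -expSetD.
Qed.

(** In [H], the part [T] keeps the original set inside, and the part [T^2 = T T^-1] receives what
    the covering lemma leaves. *)
Lemma approximate_group_sym T M : multiplicative_set T -> invSet T = T ->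
  1 <= M -> vol (expSet 3 T) <= M * vol T ->
  approximate_group (8 * M ^+ 4) (T `|` T ** T) /\
  vol (T `|` T ** T) <= 2 * M * vol T.
Proof.
move=> mT sT M1 hM; have T0 := vol_gt0 hmu mT.
have M0 : 0 < M by exact: lt_le_trans M1.
have mE k : multiplicative_set (expSet k.+1 T) by exact: multiplicative_exp.
have hE := fun n => vol_exp n mT sT M1 hM.
have HE : T `|` T ** T = expSet 1 T `|` expSet 2 T by [].
rewrite HE; set H := _ `|` _.
have mH : multiplicative_set H by exact: multiplicative_setU.
have sH : invSet H = H by rewrite invSetU !invSet_exp.
have mHH := multiplicative_mul mH mH.
split; last first.
  apply: le_trans (vol_setU hmu (mE 0%N) (mE 1%N)) _.
  apply: le_trans (lerD (hE 0%N) (hE 1%N)) _.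
  rewrite -mulrDl ler_pM2r // expr0 expr1; lra.
split => //.
have [X [XHH cX HHX]] := Ruzsa_covering mHH mT.
(* Adding inverses makes [X] symmetric; it stays in [H H], which is symmetric, and the size at most
   doubles, from [4 M^4] to [8 M^4]. *)
exists (X `|` [fset (x^-1)%g | x in X])%fset.
have XE : [set` (X `|` [fset (x^-1)%g | x in X])%fset] = [set` X] `|` invSet [set` X].
  apply/seteqP; split=> x /=; rewrite !inE.
    move=> /orP[Xx|/imfsetP[/= y Xy ->]]; [by left|by right; exists y].
  move=> [->//|[y Xy <-]]; apply/orP; right.
  by apply/imfsetP; exists y.
rewrite XE; split.
- by rewrite invSetU invSetK setUC.
- rewrite subUset; split=> // _ [x /XHH HHx <-].
  by rewrite -sH -invSetM; exists x.
(* [H H T] is the union of [T^3], [T^4], [T^4] and [T^5], each of volume at most [M^4 vol T]. *)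
- have hHHT : vol (H ** H ** T) <= 4 * M ^+ 4 * vol T.
    have -> : H ** H ** T = (expSet 3 T `|` expSet 4 T) `|` (expSet 4 T `|` expSet 5 T).
      by rewrite !mulSetUl !mulSetUr !mulSetUl -!mulSetA.
    have mU S S' := @multiplicative_setU G S S'.
    apply: le_trans (vol_setU hmu _ _) _; try exact: mU.
    apply: le_trans (lerD (vol_setU hmu _ _) (vol_setU hmu _ _)) _ => //.
    apply: le_trans (lerD (lerD (hE 2%N) (hE 3%N)) (lerD (hE 3%N) (hE 4%N))) _.
    rewrite -!mulrDl ler_pM2r //.
    have h2 : M ^+ 2 <= M ^+ 4 by exact: ler_weXn2l.
    have h3 : M ^+ 3 <= M ^+ 4 by exact: ler_weXn2l.
    lra.
  have cX4 : #|` X|%:R <= 4 * M ^+ 4 :> R.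
    by rewrite -(ler_pM2r T0); exact: le_trans cX hHHT.
  apply: (@le_trans _ _ (#|` X|%:R + #|` X|%:R)); last by lra.
  rewrite -natrD ler_nat; apply: leq_trans (leq_card_fsetU _ _).1 _.
  by rewrite leq_add2l card_imfset //; exact: invg_inj.
- apply: subset_trans HHX _; apply: mulSetS; first by move=> x; left.
  by rewrite sT => x; right.
Qed.

Lemma approximate_group_tripling A H K c :
  multiplicative_set A -> approximate_group K H -> A `<=` H ->
  vol H <= c * vol A -> vol (A ** A ** A) <= K * K * c * vol A.
Proof.
move=> mA [mH sH [X [_ _ XK HHX]]] AH Hc.
have mAAA : multiplicative_set (A ** A ** A) by exact: multiplicative_mul3.
have oH : open H by case: mH.
have K0 : 0 <= K by exact: le_trans XK.
have AX : A ** A ** A `<=` [set` X] ** ([set` X] ** H).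
  apply: (@subset_trans _ (H ** H ** H)); first by do 2![apply: mulSetS => //].
  apply: (@subset_trans _ ([set` X] ** H ** H)); first exact: mulSetS.
  by rewrite -mulSetA; exact: mulSetS.
rewrite -lee_fin -multiplicative_measure //.
apply: (@le_trans _ _ (mu ([set` X] ** ([set` X] ** H)))).
  apply: le_measure; rewrite ?inE //; apply: open_bmeasurable.
  - by case: mAAA.
  - by do 2![apply: open_mulr => //].
apply: le_trans (measure_fset_mul _ _) _; first exact: open_mulr.
have cX : (0 <= (#|` X|%:R : R)%:E)%E by rewrite lee_fin.
apply: le_trans (lee_wpmul2l cX (measure_fset_mul X oH)) _.
rewrite (multiplicative_measure hmu mH) -!EFinM lee_fin -!mulrA.
have H0 : 0 <= vol H by exact/ltW/vol_gt0.
by apply: ler_pM => //; exact: ler_pM.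
Qed.

End Growth.

(** * Bookkeeping of implied constants *)

Section Constants.
Context {R : realType}.

(** The implied constant is both a factor and an exponent. Since [k (C K^C)^n = (k C^n) K^(n C)],
    for [K >= 1] the larger of [k C^n] and [n C] serves in both roles. *)
Definition absorb (k : R) (n : nat) (C : R) := Num.max (k * C ^+ n) (n%:R * C).

Lemma absorb_gt0 k n C : 0 < k -> 0 < C -> 0 < absorb k n C.
Proof. by move=> k0 C0; rewrite lt_max mulr_gt0 ?exprn_gt0. Qed.

Lemma absorbP k n C K : 0 < k -> 0 < C -> 1 <= K ->
  k * (C * K `^ C) ^+ n <= absorb k n C * K `^ absorb k n C.
Proof.
move=> k0 C0 K1; rewrite exprMn mulrA -(powR_mulrn n (powR_ge0 K C)) -powRrM.
apply: ler_pM; rewrite ?powR_ge0 //.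
- by rewrite mulr_ge0 ?exprn_ge0 // ltW.
- by rewrite le_max lexx.
- by apply: ler_powR => //; rewrite le_max [C * _]mulrC lexx orbT.
Qed.

End Constants.

(** * The implications between the three statements *)

Section Equivalence.
Context {R : realType} {G : topologicalGroupType}.
Context (mu : {measure set (borelType G) -> \bar R}).
Context (hmu : multiplicative_group mu).
Implicit Types (A B H S T : set G) (K C : R).

Local Notation vol S := (fine (mu S)).

Lemma lesssimE C K S A : multiplicative_set S -> multiplicative_set A ->
  lesssim C K (mu S) (mu A) <-> vol S <= C * K `^ C * vol A.
Proof.
move=> mS mA; rewrite /lesssim (multiplicative_measure hmu mS).
by rewrite (multiplicative_measure hmu mA) -EFinM lee_fin.
Qed.

(** The two volume bounds force [C K^C >= 1], so the lower estimate follows from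
    [vol A <= vol S]. *)
Lemma polysimI C K c S A : multiplicative_set S -> multiplicative_set A ->
  vol A <= vol S -> vol S <= c * vol A -> c <= C * K `^ C ->
  polysim C K (mu S) (mu A).
Proof.
move=> mS mA AS Sc cC; have A0 := vol_gt0 hmu mA.
have SC : vol S <= C * K `^ C * vol A.
  by apply: le_trans Sc _; rewrite ler_pM2r.
split; first exact/lesssimE.
have C1 : 1 <= C * K `^ C.
  by rewrite -(ler_pM2r A0) mul1r; exact: le_trans SC.
rewrite /gtrsim (multiplicative_measure hmu mS) (multiplicative_measure hmu mA).
rewrite -EFinM lee_fin; apply: le_trans AS.
rewrite powRN -invfM; apply: ler_piMl; first exact: ltW.
by rewrite invf_le1 // (lt_le_trans _ C1).
Qed.

Lemma approximate_group_le K K' H :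
  K <= K' -> approximate_group K H -> approximate_group K' H.
Proof.
move=> KK' [mH sH [X [sX XH cX HX]]]; split=> //; exists X; split=> //.
exact: le_trans KK'.
Qed.

Lemma vol_sign_prod_ge n (eps : 'I_n -> bool) A : (0 < n)%N ->
  multiplicative_set A -> vol A <= vol (sign_prodSet eps A).
Proof.
move=> + mA; elim: n eps => // -[|n] IH eps _.
  rewrite /sign_prodSet big_ord_recl big_ord0 mulSet1r /signSet.
  by case: (eps _) => //; rewrite vol_inv.
rewrite /sign_prodSet big_ord_recl.
apply: le_trans (IH (fun i => eps (lift ord0 i)) isT) _.
apply: vol_le_mull => //; last exact: multiplicative_sign_prod.
by rewrite /signSet; case: (eps _) => //; exact: multiplicative_inv.
Qed.

Lemma sign_prodSet_pos n A : sign_prodSet (fun _ : 'I_n => false) A = expSet n A.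
Proof.
elim: n => [|n IH]; first by rewrite /sign_prodSet big_ord0.
by rewrite expSetS -IH /sign_prodSet big_ord_recl.
Qed.

Lemma small_tripling_consequences C K A : 0 < C -> 1 <= K ->
  multiplicative_set A -> small_tripling mu C K A ->
  small_sign_products mu (fun n => absorb (2 * 8 ^+ n) (3 * n) C) K A /\
  in_approximate_group mu (absorb (8 ^+ 5) 12 C) K A.
Proof.
move=> C0 K1 mA /lesssimE hA.
have A0 := vol_gt0 hmu mA.
set L := C * K `^ C in hA.
have {}hA : vol (A ** A ** A) <= L * vol A.
  by rewrite -expSet3; apply: hA => //; exact: multiplicative_exp.
(* [C] may be less than 1; that [L >= 1] comes from [vol A <= vol (A^3)]. *)
have L1 : 1 <= L.
  rewrite -(ler_pM2r A0) mul1r; apply: le_trans hA.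
  by apply: vol_le_mull => //; exact: multiplicative_mul.
set M := 8 * L ^+ 3.
have M1 : 1 <= M.
  by rewrite /M; have := exprn_ege1 3 L1; lra.
set T := A `|` invSet A.
have mT : multiplicative_set T.
  by apply: multiplicative_setU => //; exact: multiplicative_inv.
have sT : invSet T = T by rewrite invSetU invSetK setUC.
have AT : vol A <= vol T by apply: vol_le => // x; left.
have T2 : vol T <= 2 * vol A.
  have := vol_setU hmu mA (multiplicative_inv mA).
  by rewrite (vol_inv hmu mA) -/T; lra.
have T3 : vol (expSet 3 T) <= M * vol T.
  apply: le_trans (sym_hull_tripling hmu mA L1 hA) _.
  by rewrite ler_pM2l // (lt_le_trans _ M1).
split.
- move=> [//|n] eps n1.
  (* For [n+1] factors, [M^n] comes from the growth of [T] and 2 from [vol T <= 2 vol A]. *)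
  apply: (@polysimI _ _ (M ^+ n * 2)) => //.
  + exact: multiplicative_sign_prod.
  + exact: vol_sign_prod_ge.
  + apply: (@le_trans _ _ (vol (expSet n.+1 T))).
      apply: vol_le => //; [exact: multiplicative_sign_prod|exact: multiplicative_exp|].
      by apply: sign_prodSet_sub => x; [left|right].
    apply: le_trans (vol_exp hmu n mT sT M1 T3) _.
    by rewrite -mulrA ler_pM2l // exprn_gt0 // (lt_le_trans _ M1).
  (* [M^n] is relaxed to [M^(n+1) = 8^(n+1) L^(3(n+1))], so that the constant is indexed by the
     number of factors. *)
  + have k0 : 0 < 2 * 8 ^+ n.+1 :> R by rewrite mulr_gt0 ?exprn_gt0.
    apply: le_trans (absorbP (3 * n.+1) k0 C0 K1); rewrite -/L.
    rewrite exprM -mulrA -exprMn -/M mulrC ler_pM2l //.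
    exact: ler_weXn2l.
- have [aH vH] := approximate_group_sym hmu mT sT M1 T3.
  have mH : multiplicative_set (T `|` T ** T) by case: aH.
  have AH : A `<=` T `|` T ** T by move=> x Ax; left; left.
  (* Here [8 M^4 = 8^5 L^12]. *)
  have M4 : 8 * M ^+ 4 <= absorb (8 ^+ 5) 12 C * K `^ absorb (8 ^+ 5) 12 C.
    apply: le_trans (absorbP 12 _ C0 K1); rewrite ?exprn_gt0 // -/L.
    by rewrite /M exprMn -exprM mulrA -exprS.
  exists (T `|` T ** T); split => //; first exact: approximate_group_le aH.
  (* The same constant covers the volume of [H], as [2 M vol T <= 4 M vol A <= 8 M^4 vol A]. *)
  apply: (polysimI _ _ _ _ M4) => //; first exact: vol_le.
  apply: le_trans vH _.
  have MM : M <= M ^+ 4 by rewrite -[X in X <= _]expr1; exact: ler_weXn2l.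
  nra.
Qed.

Lemma in_approximate_group_tripling C K A : 0 < C -> 1 <= K ->
  multiplicative_set A -> in_approximate_group mu C K A ->
  small_tripling mu (absorb 1 3 C) K A.
Proof.
move=> C0 K1 mA [H [aH [/lesssimE hH _] AH]].
have mH : multiplicative_set H by case: aH.
apply/lesssimE => //; first exact: multiplicative_exp.
rewrite expSet3.
(* Two factors [X] and the volume of [H] each cost [C K^C], hence the exponent 3. *)
apply: le_trans (approximate_group_tripling hmu mA aH AH (hH mH mA)) _.
rewrite ler_pM2r ?vol_gt0 //.
apply: le_trans (absorbP 3 ltr01 C0 K1); rewrite mul1r.
by rewrite exprSr expr2.
Qed.

End Equivalence.

(** The constants are chosen before [G], [mu], [K] and [A], which makes them absolute; those of (ii)
    form a sequence, as they may depend on the number of factors. Every implication passes through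
    (i). *)
Theorem theorem3p9 (R : realType) :
  [/\ forall C1 : R, 0 < C1 ->
        exists (c2 : nat -> R) (C3 : R),
          [/\ forall n, 0 < c2 n, 0 < C3 &
            forall (G : topologicalGroupType)
                   (mu : {measure set (borelType G) -> \bar R})
                   (K : R) (A : set G),
              multiplicative_group mu -> 1 <= K -> multiplicative_set A ->
              small_tripling mu C1 K A ->
              small_sign_products mu c2 K A /\ in_approximate_group mu C3 K A],
      forall c2 : nat -> R, (forall n, 0 < c2 n) ->
        exists C1 C3 : R,
          [/\ 0 < C1, 0 < C3 &
            forall (G : topologicalGroupType)
                   (mu : {measure set (borelType G) -> \bar R})
                   (K : R) (A : set G),
              multiplicative_group mu -> 1 <= K -> multiplicative_set A ->
              small_sign_products mu c2 K A ->
              small_tripling mu C1 K A /\ in_approximate_group mu C3 K A]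
    & forall C3 : R, 0 < C3 ->
        exists (C1 : R) (c2 : nat -> R),
          [/\ 0 < C1, forall n, 0 < c2 n &
            forall (G : topologicalGroupType)
                   (mu : {measure set (borelType G) -> \bar R})
                   (K : R) (A : set G),
              multiplicative_group mu -> 1 <= K -> multiplicative_set A ->
              in_approximate_group mu C3 K A ->
              small_tripling mu C1 K A /\ small_sign_products mu c2 K A]].
Proof.
have k2 n : 0 < 2 * 8 ^+ n :> R by rewrite mulr_gt0 ?exprn_gt0.
have k3 : 0 < 8 ^+ 5 :> R by rewrite exprn_gt0.
split.
- move=> C1 C10.
  exists (fun n => absorb (2 * 8 ^+ n) (3 * n) C1), (absorb (8 ^+ 5) 12 C1).
  split=> [n||G mu K A hmu K1 mA h]; try exact: absorb_gt0.
  exact: small_tripling_consequences.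
- move=> c2 c20; exists (c2 3%N), (absorb (8 ^+ 5) 12 (c2 3%N)).
  split=> [//||G mu K A hmu K1 mA h]; first exact: absorb_gt0.
  (* Only three factors with all signs +1, encoded by [false], are used. *)
  have h3 : small_tripling mu (c2 3%N) K A.
    by have [+ _] := h 3%N (fun=> false) isT; rewrite sign_prodSet_pos.
  by split=> //; have [] := small_tripling_consequences hmu (c20 3%N) K1 mA h3.
- move=> C3 C30; have C10 := absorb_gt0 3 ltr01 C30.
  exists (absorb 1 3 C3), (fun n => absorb (2 * 8 ^+ n) (3 * n) (absorb 1 3 C3)).
  split=> [//|n|G mu K A hmu K1 mA h]; first exact: absorb_gt0.
  have h3 := in_approximate_group_tripling hmu C30 K1 mA h.
  by split=> //; have [] := small_tripling_consequences hmu C10 K1 mA h3.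
Qed.
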